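(* Let $b\geq 2$ be an integer. (i) For any nonnegative integers $k$ and $m$ with $k\leq m$, \[ S_b(m+k)+S_b(m-k)-2S_b(m)\leq \left[\frac{b+1}{2}\right]k . \] The constant $[(b+1)/2]$ cannot be replaced by a smaller constant: for every real $c<[(b+1)/2]$ there exist nonnegative integers $k\le m$ with $S_b(m+k)+S_b(m-k)-2S_b(m)> ck$. Moreover, if $b$ is odd, the inequality is strict whenever $1\leq k\leq m$. (ii) For any nonnegative integer $n$ and positive integer $k$, \[ \bar{s}_b(n,n+2k)\leq \bar{s}_b(n,n+k)+\frac12\left[\frac{b+1}{2}\right]. \]
   Context: For an integer $b\geq 2$ and $n\in\mathbb{Z}_{\ge 0}$, $s_b(n)$ is the sum of the base-$b$ digits of $n$, and $S_b(N)=\sum_{n=0}^{N-1}s_b(n)$ (with $S_b(0)=0$). For integers $0\leq s<t$, $\bar{s}_b(s,t)=\frac{S_b(t)-S_b(s)}{t-s}=\frac{1}{t-s}\sum_{n=s}^{t-1}s_b(n)$. $[x]$ denotes the greatest integer $\le x$. *)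

(* Defs.v *)
From HB Require Export structures.
From mathcomp Require Export all_boot all_order all_algebra.
From mathcomp Require Export reals.

Set Implicit Arguments.
Unset Strict Implicit.
Unset Printing Implicit Defensive.

Import Order.TTheory GRing.Theory Num.Theory.

(* The coefficient of b ^ i in the base-b expansion of n. *)
Definition digit (b n i : nat) : nat := (n %/ b ^ i) %% b.

(* For b >= 2 we have n < b ^ i as soon as n <= i, so every digit of index
   i > n vanishes and the sum below runs over all nonzero digits of n. *)
Definition digit_sum (b n : nat) : nat := \sum_(i < n.+1) digit b n i.

Definition cumul_digit_sum (b N : nat) : nat := \sum_(0 <= n < N) digit_sum b n.

Local Open Scope ring_scope.

Definition mean_digit_sum (R : realType) (b s t : nat) : R :=
  ((cumul_digit_sum b t)%:R - (cumul_digit_sum b s)%:R) / (t%:R - s%:R).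

(* Main.v *)
Require Import Defs.
From HB Require Import structures.
From mathcomp Require Import all_boot all_order all_algebra.
From mathcomp Require Import reals.
From mathcomp Require Import zify ring.
Import Order.TTheory GRing.Theory Num.Theory.
Local Open Scope ring_scope.

(** Since [s_b (b n + r) = s_b n + r], the function [S_b] on the block
    [bn, ..., bn + b] is [b] times the linear interpolation of [S_b] between [n]
    and [n + 1], plus a linear term, plus [- r (b - r) / 2].  Extend
    [S_b u + S_b v - 2 S_b ((u + v) / 2)] to pairs [u, v] with a half-integral
    midpoint by linear interpolation.  With [u = b a + r1] and [v = b c + r2], this
    gap is, up to an explicit quadratic term, affine in [(r1, r2)]: on the whole
    square [[0, b]^2] when [a + c] is even, and on each of the two triangles
    [r1 + r2 <= b] and [r1 + r2 >= b] when [a + c] is odd.  Hence an upper bound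
    depending only on [v - u] propagates from the vertices, i.e. from smaller pairs.
    The bound [C d] on twice the gap, with [d = v - u] and [C = floor ((b + 1) / 2)],
    does not propagate by itself, because of the quadratic term; it does after
    subtracting [C] for odd [d] and, when [b] is odd, [1] for even [d > 0].

    The constant is attained at [m = k = b / 2] for even [b], and approached at
    [m = k = (b ^ j - 1) / 2] for odd [b]. *)

(** * Digit sums under appending a digit *)

Lemma digit_sum_widen (b n N : nat) : (1 < b)%N -> (n < N)%N ->
  digit_sum b n = (\sum_(i < N) digit b n i)%N.
Proof.
move=> b1 nN; rewrite /digit_sum -!(big_mkord xpredT (digit b n)).
rewrite (@big_cat_nat _ _ _ n.+1 0 N) //=.
rewrite [X in _ = (_ + X)%N]big_nat_cond [X in _ = (_ + X)%N]big1 ?addn0 //.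
move=> i /andP[/andP[ni _] _]; rewrite /digit divn_small ?mod0n //.
by apply: ltn_trans ni _; rewrite ltn_expl.
Qed.

Lemma digit_sum_mulD (b n r : nat) : (1 < b)%N -> (r < b)%N ->
  digit_sum b (b * n + r) = (digit_sum b n + r)%N.
Proof.
move=> b1 rb.
rewrite (@digit_sum_widen b (b * n + r) (b * n + r).+2) // big_ord_recl.
rewrite (@digit_sum_widen b n (b * n + r).+1) //; last first.
  by rewrite ltnS; apply: leq_trans (leq_addr _ _); rewrite leq_pmull // ltnW.
rewrite /digit expn0 divn1 mulnC modnMDl modn_small // addnC; congr (_ + _)%N.
apply: eq_bigr => i _; rewrite lift0 expnS divnMA divnMDl ?(ltnW b1) //.
by rewrite (divn_small rb) addn0.
Qed.

(** * Cumulative sums on a block of length [b] *)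

Local Notation S b n := (Posz (cumul_digit_sum b n)).

Lemma cumul_digit_sum0 b : S b 0 = 0.
Proof. by rewrite /cumul_digit_sum big_nil. Qed.

Lemma cumul_digit_sumS b n : S b n.+1 = S b n + (digit_sum b n)%:Z.
Proof. by rewrite /cumul_digit_sum big_nat_recr //= PoszD. Qed.

Lemma cumul_digit_sum1 b : S b 1 = 0.
Proof.
by rewrite cumul_digit_sumS cumul_digit_sum0 /digit_sum big_ord_recl big_ord0 /digit div0n mod0n.
Qed.

Lemma cumul_block (b n r : nat) : (1 < b)%N -> (r <= b)%N ->
  2 * S b (b * n + r)%N =
  2 * S b (b * n)%N + 2 * r%:Z * (digit_sum b n)%:Z + r%:Z * (r%:Z - 1).
Proof.
move=> b1; elim: r => [|r IH] rb; first by rewrite addn0; ring.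
rewrite addnS cumul_digit_sumS digit_sum_mulD // mulrDr IH 1?ltnW //.
rewrite PoszD (intS r); ring.
Qed.

Lemma cumul_mul (b n : nat) : (1 < b)%N ->
  2 * S b (b * n)%N = 2 * b%:Z * S b n + n%:Z * b%:Z * (b%:Z - 1).
Proof.
move=> b1; elim: n => [|n IH]; first by rewrite muln0 cumul_digit_sum0; ring.
rewrite mulnS addnC cumul_block // IH cumul_digit_sumS (intS n); ring.
Qed.

(** The factor 2 keeps [r (r - 1) / 2] integral. Allowing [r = b] lets a midpoint fall on the right
    end of its block without a separate case. *)
Lemma cumul_interp (b n r : nat) : (1 < b)%N -> (r <= b)%N ->
  2 * S b (b * n + r)%N =
  2 * (b%:Z - r%:Z) * S b n + 2 * r%:Z * S b n.+1
  + n%:Z * b%:Z * (b%:Z - 1) + r%:Z * (r%:Z - 1).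
Proof.
by move=> b1 rb; rewrite cumul_block // cumul_mul // cumul_digit_sumS; ring.
Qed.

(** * The midpoint gap and the correction to its bound *)

Definition midgap (b u v : nat) : int :=
  S b u + S b v - S b (u + v)./2 - S b (uphalf (u + v)).

Lemma midgapE b u v q (e : bool) : (u + v = 2 * q + e)%N ->
  midgap b u v = S b u + S b v - S b q - S b (q + e)%N.
Proof.
move=> uvE; rewrite /midgap (_ : (u + v)./2 = q); last lia.
by rewrite (_ : uphalf (u + v) = (q + e)%N) //; lia.
Qed.

(** The correction must vanish at [d = 0], where the gap is 0. At [d = 1] the gap is again 0, so [C]
    is the largest correction possible. *)
Definition slack (b d : nat) : int :=
  if odd d then (uphalf b)%:Z else if d == 0%N then 0 else (odd b : nat)%:Z.

Lemma slack_ge0 b d : 0 <= slack b d.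
Proof. by rewrite /slack; case: ifP => // _; case: ifP. Qed.

Lemma slack_oddE b d : odd d -> slack b d = (uphalf b)%:Z.
Proof. by rewrite /slack => ->. Qed.

Lemma slack_evenE b d : ~~ odd d -> (0 < d)%N -> slack b d = (odd b : nat)%:Z.
Proof. by rewrite /slack => /negbTE -> ; case: d. Qed.

Lemma slack_even_le b d : ~~ odd d -> slack b d <= (odd b : nat)%:Z.
Proof. by rewrite /slack => /negbTE ->; case: ifP. Qed.

(** The numerical part of the induction for [a + c] even, with [l = c - a] and [t] the distance of
    the residues. The vertices at distance [l] have total weight [b - t], the one at odd distance
    [l + 1] or [l - 1] has weight [t], and the last term is twice the quadratic one. The key point
    is [t./2 < C]. *)
Lemma slack_step_even b l d t : (1 < b)%N -> ~~ odd l -> (t < b)%N ->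
    d = (b * l + t)%N \/ (d + t = b * l)%N ->
  slack b d <= (b%:Z - t%:Z) * slack b l + t%:Z * (uphalf b)%:Z
               - 2 * (t./2)%:Z * (uphalf t)%:Z.
Proof.
move=> b1 el tb dE; have sl0 := slack_ge0 b l.
have ebl : ~~ odd (b * l) by rewrite oddM (negbTE el) andbF.
have [ot|et] := boolP (odd t).
- rewrite (slack_oddE b d); last by lia.
  have [p tE] : exists p, t = (2 * p + 1)%N by exists t./2; lia.
  have -> : t./2 = p by lia.
  have -> : uphalf t = p.+1 by lia.
  have : (p.+1 <= uphalf b)%N by lia.
  nia.
- have ed : ~~ odd d by lia.
  have [p tE] : exists p, t = (2 * p)%N by exists t./2; lia.
  have -> : t./2 = p by lia.
  have -> : uphalf t = p by lia.
  have [p0|p0] := posnP p.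
    have [l0|l0] := posnP l; first by
      have -> : d = 0%N; [move: dE; rewrite l0 muln0; lia | rewrite l0 /slack /=; nia].
    have := @slack_even_le b d ed.
    rewrite (@slack_evenE b l) //; nia.
  have := @slack_even_le b d ed.
  have : (p.+1 <= uphalf b)%N by lia.
  have : (odd b <= 1)%N by case: odd.
  nia.
Qed.

(** The analogue for [l = c - a] odd. The weights [z], [r2], [r1] belong to distances [l], [l + 1],
    [l - 1]; as [l - 1] may be 0, no correction is credited to [r1]. The positivity condition
    excludes the vertex [r1 = b], where the right side is 0. *)
Lemma slack_step_odd b d r1 r2 z : (1 < b)%N -> (0 < r2)%N || (0 < z)%N ->
    (r1 + r2 + z = b)%N -> odd d = odd z ->
  slack b d <= r2%:Z * (odd b : nat)%:Z + z%:Z * (uphalf b)%:Z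
               - 2 * ((z./2)%:Z * (uphalf z)%:Z - r1%:Z * r2%:Z).
Proof.
move=> b1 r2z wE dz.
have [oz|ez] := boolP (odd z).
- rewrite (slack_oddE b d); last by lia.
  have [p zE] : exists p, z = (2 * p + 1)%N by exists z./2; lia.
  have -> : z./2 = p by lia.
  have -> : uphalf z = p.+1 by lia.
  have : (p.+1 <= uphalf b)%N by lia.
  nia.
- have ed : ~~ odd d by lia.
  have := @slack_even_le b d ed.
  have [p zE] : exists p, z = (2 * p)%N by exists z./2; lia.
  have -> : z./2 = p by lia.
  have -> : uphalf z = p by lia.
  have [p0|p0] := posnP p; first by nia.
  have [ob|eb] := boolP (odd b); last first.
    have : (p <= uphalf b)%N by lia.
    nia.
  have : (p.+1 <= uphalf b)%N by lia.
  nia.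
Qed.

(** * Interpolation of the gap from smaller pairs *)

Lemma midgapC b u v : midgap b u v = midgap b v u.
Proof. by rewrite /midgap addnC; ring. Qed.

(** The midpoint is [b n + (r1 + r2) / 2], always in block [n]. The weights are [b] times the
    barycentric coordinates of [(r1, r2)] in the triangle [(0, 0)], [(b, b)], [(0, b)]; the case
    [r1 > r2] follows by symmetry. *)
Lemma midgap_interp_even b a c n r1 r2 : (1 < b)%N -> (a + c = 2 * n)%N ->
    (r1 <= r2 <= b)%N ->
  midgap b (b * a + r1) (b * c + r2) =
    (b%:Z - r2%:Z) * midgap b a c + r1%:Z * midgap b a.+1 c.+1
    + (r2 - r1)%N%:Z * midgap b a c.+1
    + ((r2 - r1)./2)%:Z * (uphalf (r2 - r1))%:Z.
Proof.
move=> b1 nE /andP[r12 r2b].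
have [p [e rE]] : exists p (e : bool), (r1 + r2 = 2 * p + e)%N.
  by exists (r1 + r2)./2, (odd (r1 + r2)); lia.
have ub : (r1 <= b)%N by lia.
have pb : (p <= b)%N by lia.
have qb : (p + e <= b)%N by lia.
rewrite (@midgapE b a c n false) 1?(@midgapE b a.+1 c.+1 n.+1 false); [|lia..].
rewrite (@midgapE b a c.+1 n true) ; last lia.
rewrite (@midgapE b (b * a + r1) (b * c + r2) (b * n + p) e); last first.
  by rewrite addnACA -mulnDr nE rE; lia.
have := @cumul_interp b a r1 b1 ub.
have := @cumul_interp b c r2 b1 r2b.
have := @cumul_interp b n p b1 pb.
have := @cumul_interp b n (p + e)%N b1 qb.
rewrite !addnA !addn0 !addn1.
have -> : (r2 - r1)./2 = (p - r1)%N by lia.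
have -> : uphalf (r2 - r1) = (p + e - r1)%N by lia.
rewrite -!subzn ?PoszD; [|lia..].
have -> : r2%:Z = 2 * p%:Z + e%:Z - r1%:Z by lia.
have -> : c%:Z = 2 * n%:Z - a%:Z by lia.
have ee : e%:Z * e%:Z = e%:Z by case: (e).
move=> H1 H2 H3 H4.
apply: (@mulfI _ 2) => //; rewrite mulrBr mulrBr mulrDr H1 H2 H3 H4.
by move: ee; case: (e) => _; ring.
Qed.

(** The midpoint is [b (n + 1) - z / 2], which lies in block [n] because [r1 + r2 <= b]. *)
Lemma midgap_interp_lower b a c n r1 r2 z : (1 < b)%N ->
    (a + c = 2 * n + 1)%N -> (r1 + r2 + z = b)%N ->
  midgap b (b * a + r1) (b * c + r2) =
    z%:Z * midgap b a c + r1%:Z * midgap b a.+1 c + r2%:Z * midgap b a c.+1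
    + ((z./2)%:Z * (uphalf z)%:Z - r1%:Z * r2%:Z).
Proof.
move=> b1 nE bE.
have [p [e zE]] : exists p (e : bool), z = (2 * p + e)%N.
  by exists z./2, (odd z); lia.
have r1b : (r1 <= b)%N by lia.
have r2b : (r2 <= b)%N by lia.
have pb : (b - p - e <= b)%N by lia.
have qb : (b - p <= b)%N by lia.
rewrite (@midgapE b a.+1 c n.+1 false) 1?(@midgapE b a c.+1 n.+1 false); [|lia..].
rewrite (@midgapE b a c n true) ; last lia.
rewrite (@midgapE b (b * a + r1) (b * c + r2) (b * n + (b - p - e)) e); last first.
  rewrite addnACA -mulnDr nE; lia.
have := @cumul_interp b a r1 b1 r1b.
have := @cumul_interp b c r2 b1 r2b.
have := @cumul_interp b n (b - p - e)%N b1 pb.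
have := @cumul_interp b n (b - p)%N b1 qb.
have -> : (b * n + (b - p - e) + e = b * n + (b - p))%N by lia.
rewrite !addn0 !addn1.
have -> : z./2 = p by lia.
have -> : uphalf z = (p + e)%N by lia.
rewrite -!subzn ?PoszD; [|lia..].
have -> : z%:Z = 2 * p%:Z + e%:Z by lia.
have -> : b%:Z = r1%:Z + r2%:Z + 2 * p%:Z + e%:Z by lia.
have -> : c%:Z = 2 * n%:Z + 1 - a%:Z by lia.
move=> H1 H2 H3 H4.
apply: (@mulfI _ 2) => //; rewrite mulrBr mulrBr mulrDr H1 H2 H3 H4.
by case: (e); ring.
Qed.

(** Here [r1] and [r2] are the complements of the residues of the second and first point, so that
    they weight the same vertices as in the lower triangle. The midpoint [b (n + 1) + z / 2] lies in
    block [n + 1]. *)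
Lemma midgap_interp_upper b a c n r1 r2 z : (1 < b)%N ->
    (a + c = 2 * n + 1)%N -> (r1 + r2 + z = b)%N ->
  midgap b (b * a + (b - r2)) (b * c + (b - r1)) =
    z%:Z * midgap b a.+1 c.+1 + r1%:Z * midgap b a.+1 c + r2%:Z * midgap b a c.+1
    + ((z./2)%:Z * (uphalf z)%:Z - r1%:Z * r2%:Z).
Proof.
move=> b1 nE bE.
have [p [e zE]] : exists p (e : bool), z = (2 * p + e)%N.
  by exists z./2, (odd z); lia.
have r1b : (b - r2 <= b)%N by lia.
have r2b : (b - r1 <= b)%N by lia.
have pb : (p <= b)%N by lia.
have qb : (p + e <= b)%N by lia.
rewrite (@midgapE b a.+1 c n.+1 false) 1?(@midgapE b a c.+1 n.+1 false); [|lia..].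
rewrite (@midgapE b a.+1 c.+1 n.+1 true) ; last lia.
rewrite (@midgapE b _ _ (b * n.+1 + p) e); last first.
  rewrite addnACA -mulnDr nE mulnS; lia.
have := @cumul_interp b a _ b1 r1b.
have := @cumul_interp b c _ b1 r2b.
have := @cumul_interp b n.+1 p b1 pb.
have := @cumul_interp b n.+1 (p + e)%N b1 qb.
rewrite !addnA !addn0 !addn1.
have -> : z./2 = p by lia.
have -> : uphalf z = (p + e)%N by lia.
rewrite -!subzn ?PoszD; [|lia..].
have -> : z%:Z = 2 * p%:Z + e%:Z by lia.
have -> : b%:Z = r1%:Z + r2%:Z + 2 * p%:Z + e%:Z by lia.
have -> : c%:Z = 2 * n%:Z + 1 - a%:Z by lia.
rewrite (intS n).
move=> H1 H2 H3 H4.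
apply: (@mulfI _ 2) => //; rewrite mulrBr mulrBr mulrDr H1 H2 H3 H4.
by case: (e); ring.
Qed.

(** * The upper bound, by induction on the larger point *)

Lemma le_combine (w1 w2 w3 g1 g2 g3 x1 x2 x3 K y : int) :
    0 <= w1 -> 0 <= w2 -> 0 <= w3 -> 2 * g1 <= x1 -> 2 * g2 <= x2 -> 2 * g3 <= x3 ->
    w1 * x1 + w2 * x2 + w3 * x3 + 2 * K <= y ->
  2 * (w1 * g1 + w2 * g2 + w3 * g3 + K) <= y.
Proof.
move=> w1p w2p w3p /(ler_wpM2l w1p) h1 /(ler_wpM2l w2p) h2 /(ler_wpM2l w3p) h3.
by apply: le_trans; lia.
Qed.

Lemma midgap_le b u v : (1 < b)%N -> (u <= v)%N ->
  2 * midgap b u v <= (uphalf b)%:Z * (v%:Z - u%:Z) - slack b (v - u).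
Proof.
move=> b1; elim/ltn_ind: v u => v IH u uv.
have C1 : (1 <= uphalf b)%N by lia.
(* The induction uses pairs ending at [v %/ b + 1], which is below [v] only once [v > 2]. *)
have [v2|v3] := leqP v 2.
  have [->|[->|[-> ->]]] : u = v \/ v = u.+1 \/ u = 0%N /\ v = 2%N by lia.
  - by rewrite (@midgapE b v v v false) ?subnn ?addn0 /slack /=; lia.
  - by rewrite (@midgapE b u u.+1 u true) ?subSnn ?addn1 /slack /=; lia.
  - rewrite (@midgapE b 0 2 1 false) // addn0 cumul_digit_sum0 cumul_digit_sum1.
    have := @cumul_interp b 0 2 b1 b1.
    by rewrite muln0 add0n cumul_digit_sum0 cumul_digit_sum1 /slack /=; lia.
have b0 : (0 < b)%N by lia.
have := divn_eq u b; have := ltn_pmod u b0.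
have := divn_eq v b; have := ltn_pmod v b0.
move: (u %/ b)%N (u %% b)%N (v %/ b)%N (v %% b)%N => a r1 c r2 r2b vE r1b uE.
have cv : (c.+1 < v)%N by nia.
have ac : (a <= c)%N by nia.
have IH00 : (a <= c)%N -> _ := IH c (ltnW cv) a.
have IH01 : (a <= c.+1)%N -> _ := IH c.+1 cv a.
have IH10 : (a < c)%N -> _ := IH c (ltnW cv) a.+1.
have IH11 : (a < c.+1)%N -> _ := IH c.+1 cv a.+1.
clear IH.
rewrite mulnC in uE; rewrite mulnC in vE.
have bca : (b * c = b * a + b * (c - a))%N by rewrite -mulnDr subnKC.
have [n [e nE]] : exists n (e : bool), (a + c = 2 * n + e)%N.
  by exists (a + c)./2, (odd (a + c)); lia.
case: e nE => nE; last first.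
- rewrite addn0 in nE; have el : ~~ odd (c - a) by lia.
  have [r12|r21] := leqP r1 r2.
  + have dE : (v - u = b * (c - a) + (r2 - r1))%N by lia.
    have Hs := @slack_step_even b (c - a) (v - u) (r2 - r1) b1 el
              (leq_ltn_trans (leq_subr _ _) r2b) (or_introl dE).
    have -> : v%:Z - u%:Z = b%:Z * (c%:Z - a%:Z) + (r2%:Z - r1%:Z) by lia.
    have := @midgap_interp_even b a c n r1 r2 b1 nE.
    rewrite -uE -vE r12 (ltnW r2b) => /(_ erefl) ->.
    apply: le_combine (IH00 ac) (IH11 ac) (IH01 (leqW ac)) _; [lia..|].
    rewrite subSS (@slack_oddE b (c.+1 - a)); last lia.
    by move: Hs; rewrite -subzn // !intS; lia.
  (* Decreasing residues with [u <= v] force distinct blocks, so the pair [(a + 1, c)] is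
     ordered. *)
  + have ac' : (a < c)%N.
      rewrite ltn_neqAle ac andbT; apply/eqP => acE; subst c; lia.
    have dE : (v - u + (r1 - r2) = b * (c - a))%N by nia.
    have Hs := @slack_step_even b (c - a) (v - u) (r1 - r2) b1 el
              (leq_ltn_trans (leq_subr _ _) r1b) (or_intror dE).
    have -> : v%:Z - u%:Z = b%:Z * (c%:Z - a%:Z) + (r2%:Z - r1%:Z) by lia.
    have := @midgap_interp_even b c a n r2 r1 b1; rewrite (addnC c) => /(_ nE).
    rewrite -uE -vE (ltnW r21) (ltnW r1b) => /(_ erefl).
    rewrite midgapC (midgapC _ c a) (midgapC _ c.+1 a.+1) (midgapC _ c a.+1) => ->.
    apply: le_combine (IH00 ac) (IH11 ac) (IH10 ac') _; [lia..|].
    rewrite subSS (@slack_oddE b (c - a.+1)); last lia.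
    by move: Hs; rewrite -subzn 1?ltnW // !intS; lia.
- have ac' : (a < c)%N by lia.
  have duv : v%:Z - u%:Z = b%:Z * (c%:Z - a%:Z) + (r2%:Z - r1%:Z) by lia.
  have ol : odd (c - a) by lia.
  have uvE : (u + v = 2 * (b * n) + b + r1 + r2)%N.
    by rewrite uE vE addnACA -mulnDr nE mulnDr muln1; lia.
  have sl := slack_ge0 b (c - a.+1).
  rewrite duv; have [wb|bw] := leqP (r1 + r2) b.
  + have [z zE] : exists z, (r1 + r2 + z = b)%N by exists (b - (r1 + r2))%N; lia.
    have oz : odd (v - u) = odd z by lia.
    have z0 : (0 < r2)%N || (0 < z)%N by lia.
    have Hs := @slack_step_odd b (v - u) r1 r2 z b1 z0 zE oz.
    have := @midgap_interp_lower b a c n r1 r2 z b1 nE zE.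
    rewrite -uE -vE => ->.
    apply: le_combine (IH00 ac) (IH10 ac') (IH01 (leqW ac)) _; [lia..|].
    rewrite (@slack_oddE b (c - a)) // (@slack_evenE b (c.+1 - a)); [|lia..].
    have : 0 <= r1%:Z * slack b (c - a.+1) by rewrite mulr_ge0.
    by move: Hs; rewrite -zE !PoszD !intS; lia.
  + have [z zE] : exists z, ((b - r2) + (b - r1) + z = b)%N.
      by exists (r1 + r2 - b)%N; lia.
    have oz : odd (v - u) = odd z by lia.
    have z0 : (0 < b - r1)%N || (0 < z)%N by lia.
    have Hs := @slack_step_odd b (v - u) (b - r2) (b - r1) z b1 z0 zE oz.
    have := @midgap_interp_upper b a c n (b - r2) (b - r1) z b1 nE zE.
    rewrite (subKn (ltnW r1b)) (subKn (ltnW r2b)) -uE -vE => ->.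
    apply: le_combine (IH11 ac) (IH10 ac') (IH01 (leqW ac)) _; [lia..|].
    rewrite subSS (@slack_oddE b (c - a)) // (@slack_evenE b (c.+1 - a)); [|lia..].
    have : 0 <= (b - r2)%:Z * slack b (c - a.+1) by rewrite mulr_ge0.
    have : r1%:Z = b%:Z - (b - r1)%:Z by lia.
    have : r2%:Z = b%:Z - (b - r2)%:Z by lia.
    have : b%:Z = (b - r1)%:Z + (b - r2)%:Z + z%:Z by lia.
    move: (b - r1)%N (b - r2)%N Hs => q1 q2 Hs e1 e2 e3.
    move: Hs; rewrite e2 e3 e1 !intS; lia.
Qed.

(** The distance is [2 k], so the even correction applies. For odd [b] it gives [2 X + 1 <= 2 C k]
    for the second difference [X], hence [X + 1 <= C k] by integrality: this is the strictness. *)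
Lemma second_diff_le b k m : (1 < b)%N -> (k <= m)%N ->
  S b (m + k)%N + S b (m - k)%N - 2 * S b m + (odd b && (0 < k)%N : nat)%:Z
  <= (uphalf b)%:Z * k%:Z.
Proof.
move=> b1 km; have uv : (m - k <= m + k)%N by lia.
have := @midgap_le b _ _ b1 uv.
rewrite (@midgapE b _ _ m false); last lia.
have -> : (m + k - (m - k) = 2 * k)%N by lia.
have -> : (m + k)%N%:Z - (m - k)%N%:Z = 2 * k%:Z by lia.
rewrite addn0; have [->|k0] := posnP k; first by rewrite /slack /= andbF; lia.
by rewrite slack_evenE ?andbT; lia.
Qed.

(** * Extremal examples *)

Lemma cumul_diag_even b h : (0 < h)%N -> b = (2 * h)%N ->
  S b (h + h)%N + S b (h - h)%N - 2 * S b h = h%:Z * h%:Z.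
Proof.
move=> h0 bE; have b1 : (1 < b)%N by lia.
have hb : (h <= b)%N by lia.
have := @cumul_interp b 0 h b1 hb; have := @cumul_interp b 0 b b1 (leqnn b).
have -> : (h + h = b)%N by lia.
by rewrite subnn muln0 !add0n cumul_digit_sum0 cumul_digit_sum1 bE; lia.
Qed.

(* With [m = (b ^ j - 1) / 2], all of whose [j] digits equal [h = (b - 1) / 2]. *)
Lemma cumul_diag_odd b h j : (0 < h)%N -> b = (2 * h + 1)%N ->
  exists m : nat, [/\ (h * (j * j) <= m)%N,
    S b (2 * m)%N.+1 = S b m + S b m.+1 + h.+1%:Z * m%:Z &
    S b (2 * m)%N = 2 * S b m + h.+1%:Z * m%:Z - h%:Z * j%:Z].
Proof.
move=> h0 bE; have b1 : (1 < b)%N by lia.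
elim: j => [|j [m [jm E1 E2]]].
  by exists 0%N; split; rewrite ?muln0 ?cumul_digit_sum0 ?cumul_digit_sum1 //; lia.
exists (b * m + h)%N.
have hb : (h <= b)%N by lia.
have hb' : (h.+1 <= b)%N by lia.
have hb2 : (2 * h <= b)%N by lia.
have H1 := @cumul_interp b m h b1 hb.
have H2 := @cumul_interp b m h.+1 b1 hb'.
have H3 := @cumul_interp b (2 * m) (2 * h) b1 hb2.
have H4 := @cumul_interp b (2 * m) b b1 (leqnn b).
have e3 : (2 * (b * m + h) = b * (2 * m) + 2 * h)%N by lia.
(* This is the end of block [2 m], so its value comes from [2 m + 1] alone; the identity at
   [2 m + 1] is carried along for this reason. *)
have e4 : (2 * (b * m + h)).+1 = (b * (2 * m) + b)%N by lia.
rewrite addnS in H2.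
split.
(* As [b >= 3] and [j <= j ^ 2], one has [h (j + 1) ^ 2 <= 3 h j ^ 2 + h <= b m + h]. *)
- have : (3 * m <= b * m)%N by rewrite leq_mul2r bE; lia.
  have : (h * j <= h * (j * j))%N.
    by apply: leq_mul => //; case: (j) => // i; rewrite leq_pmulr.
  lia.
- rewrite e4; move: H4; rewrite E1 E2 => H4; apply: (@mulfI _ 2) => //.
  rewrite H4 !mulrDr H1 H2 bE !PoszD !PoszM !intS; ring.
- rewrite e3; move: H3; rewrite E1 E2 => H3; apply: (@mulfI _ 2) => //.
  rewrite H3 mulrBr !mulrDr (mulrCA 2 2) H1 bE !PoszD !PoszM !intS; ring.
Qed.

(** * Transfer to the reals and conclusion *)

Lemma floor_half_succ (R : realType) (b : nat) :
  Num.floor ((b%:R + 1) / 2 : R) = (uphalf b)%:Z.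
Proof.
apply: Num.Theory.floor_def.
rewrite ler_pdivlMr // ltr_pdivrMr //.
have -> : (uphalf b)%:Z + 1 = (uphalf b).+1%:Z by lia.
by rewrite -!pmulrn natr1 -!natrM ler_nat ltr_nat; lia.
Qed.

Lemma natr_second_diff (R : realType) (b k m : nat) :
  (cumul_digit_sum b (m + k))%:R + (cumul_digit_sum b (m - k))%:R
    - 2 * (cumul_digit_sum b m)%:R =
  (S b (m + k)%N + S b (m - k)%N - 2 * S b m)%:~R :> R.
Proof. by rewrite rmorphB rmorphD rmorphM /= -!pmulrn. Qed.

Theorem theorem3 (R : realType) (b : nat) (hb : (2 <= b)%N) :
  [/\ (forall k m : nat, (k <= m)%N ->
        (cumul_digit_sum b (m + k))%:R + (cumul_digit_sum b (m - k))%:R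
          - 2 * (cumul_digit_sum b m)%:R
        <= (Num.floor ((b%:R + 1) / 2 : R))%:~R * k%:R :> R),
      (forall c : R, c < (Num.floor ((b%:R + 1) / 2 : R))%:~R ->
        exists k m : nat, (k <= m)%N /\
          c * k%:R <
          (cumul_digit_sum b (m + k))%:R + (cumul_digit_sum b (m - k))%:R
            - 2 * (cumul_digit_sum b m)%:R),
      (odd b -> forall k m : nat, (1 <= k)%N -> (k <= m)%N ->
        (cumul_digit_sum b (m + k))%:R + (cumul_digit_sum b (m - k))%:R
          - 2 * (cumul_digit_sum b m)%:R
        < (Num.floor ((b%:R + 1) / 2 : R))%:~R * k%:R :> R)
    & (forall n k : nat, (0 < k)%N ->
        mean_digit_sum R b n (n + 2 * k)
        <= mean_digit_sum R b n (n + k)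
           + 1 / 2 * (Num.floor ((b%:R + 1) / 2 : R))%:~R)].
Proof.
have upper k m : (k <= m)%N ->
    (cumul_digit_sum b (m + k))%:R + (cumul_digit_sum b (m - k))%:R
      - 2 * (cumul_digit_sum b m)%:R <= (uphalf b)%:~R * k%:R :> R.
  move=> km; have := @second_diff_le b k m hb km.
  by rewrite natr_second_diff (pmulrn _ k) -intrM ler_int; lia.
rewrite floor_half_succ; split=> //.
- move=> c cC; have [ob|eb] := boolP (odd b).
  + have [h bE] : exists h, b = (2 * h + 1)%N by exists b./2; lia.
    have h0 : (0 < h)%N by lia.
    have d0 : 0 < (uphalf b)%:~R - c by rewrite subr_gt0.
    set d := _ - c in d0.
    (* The example misses [C m] by [h j], while [d m >= d h j ^ 2]; hence [j d > 1] suffices. *)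
    pose j := (Num.bound (d^-1)).+1.
    have jd : 1 < j%:R * d.
      rewrite -ltr_pdivrMr // mul1r.
      apply: lt_trans (_ : (Num.bound d^-1)%:R < _); last by rewrite ltr_nat.
      by apply: archi_boundP; rewrite invr_ge0 ltW.
    have [m [jm _ E]] := @cumul_diag_odd b h j h0 bE.
    exists m, m; split=> //; rewrite natr_second_diff.
    rewrite subnn cumul_digit_sum0 addr0 addnn -mul2n E.
    have CE : uphalf b = h.+1 by lia.
    have -> : 2 * S b m + h.+1%:Z * m%:Z - h%:Z * j%:Z - 2 * S b m
              = (uphalf b)%:Z * m%:Z - h%:Z * j%:Z by rewrite CE; ring.
    rewrite rmorphB !rmorphM /= -!pmulrn ltrBrDr -ltrBrDl -mulrBl -[_ - c]/d.
    have hj : 0 < h%:R * j%:R :> R by rewrite mulr_gt0 ?ltr0n.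
    apply: (@lt_le_trans _ _ (h%:R * j%:R * (j%:R * d))).
      by rewrite ltr_pMr.
    rewrite mulrA mulrC ler_pM2l // -!natrM.
    by rewrite ler_nat -mulnA.
  + have [h bE] : exists h, b = (2 * h)%N by exists b./2; lia.
    have h0 : (0 < h)%N by lia.
    exists h, h; split=> //; rewrite natr_second_diff (@cumul_diag_even b h) //.
    rewrite intrM -pmulrn ltr_pM2r ?ltr0n //.
    by move: cC; rewrite (_ : uphalf b = h) //; lia.
- move=> ob k m k0 km; have := @second_diff_le b k m hb km.
  by rewrite natr_second_diff (pmulrn _ k) -intrM ltr_int ob k0; lia.
(* Part (ii) is part (i) centred at [n + k], divided by [2 k]. *)
- move=> n k k0; have := upper k (n + k)%N (leq_addl _ _).
  have k0' : 0 < k%:R :> R by rewrite ltr0n.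
  rewrite addnK /mean_digit_sum -addnA addnn -mul2n (natrD _ n) (natrD _ n k) natrM.
  rewrite ![n%:R + _]addrC !addrK.
  move: (cumul_digit_sum b _)%:R => x; move: (cumul_digit_sum b n)%:R => y.
  move: (cumul_digit_sum b _)%:R => z H.
  rewrite -subr_ge0.
  have -> : (z - y) / k%:R + 1 / 2 * (uphalf b)%:~R - (x - y) / (2 * k%:R)
    = ((uphalf b)%:~R * k%:R - (x + y - 2 * z)) / (2 * k%:R).
    by field; rewrite gt_eqF.
  by rewrite divr_ge0 ?subr_ge0 ?mulr_ge0 // ltW.
Qed.
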